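(* Let $T$ be a finite tree whose core $T^*$ is nonempty. Let $S\subseteq T$ be a subtree with $|S|=k$ and $k\le |T^*|$. If $\mu_T(S)$ is minimal among the local means of all subtrees of $T$ of order $k$, then $S$ has no more than one leaf (of $S$) whose degree in $T$ is at most $2$, and at least one leaf (of $S$) whose degree in $T$ is at least $3$. Specifically, for $k=1$, a vertex that attains the minimal local mean among all vertices of $T$ has degree at least $3$ in $T$.
   Context: A subtree of a tree $T$ is a nonempty connected subgraph; $|T|$ denotes the number of vertices of $T$. For a subtree $S\subseteq T$, let $N_T(S)$ be the number of subtrees of $T$ containing $S$ and $R_T(S)$ the sum of the orders (numbers of vertices) of all subtrees of $T$ containing $S$. The local mean at $S$ is $\mu_T(S)=R_T(S)/N_T(S)$; for a vertex $v$, the local mean at $v$ is $\mu_T(\{v\})$. A leaf of $S$ is a vertex of degree $1$ in $S$; if $S$ has only one vertex, that vertex is regarded as the (only) leaf of $S$. A limb of $T$ is a maximal path in $T$ consisting of a leaf of $T$ and vertices of degree $2$ in $T$ (so if $T$ is not a path, a limb consists of a leaf together with all degree-$2$ vertices on the way from it up to, but not including, the first vertex of degree at least $3$; if $T$ is a path, all of $T$ is a limb). The core $T^*$ of $T$ is what remains of $T$ after removing all vertices of all limbs; in particular $T^*=\emptyset$ if $T$ is a path, and $T^*$ is a subtree of $T$ otherwise. *)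

(* Defs.v *)
From mathcomp Require Import all_boot all_order all_algebra.

Set Implicit Arguments.
Unset Strict Implicit.
Unset Printing Implicit Defensive.

Import Order.TTheory GRing.Theory Num.Theory.

(* A pair (vertices, edges), an edge {x, y} being recorded as both (x, y) and
   (y, x). Only the pairs satisfying [is_graph] are simple graphs. The vertex
   set need not be the whole type V, so that a graph and its subgraphs all have
   the same type. *)
Definition graph (V : finType) : finType := ({set V} * {set V * V})%type.

Definition vset (V : finType) (G : graph V) : {set V} := G.1.
Definition eset (V : finType) (G : graph V) : {set V * V} := G.2.

Definition adj (V : finType) (G : graph V) : rel V :=
  fun x y => (x, y) \in eset G.

Definition is_graph (V : finType) (G : graph V) : bool :=
  [forall x, forall y, adj G x y ==>
     [&& x \in vset G, y \in vset G, x != y & adj G y x]].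

Definition nverts (V : finType) (G : graph V) : nat := #|vset G|.

Definition deg (V : finType) (G : graph V) (x : V) : nat :=
  #|[set y | adj G x y]|.

Definition connected (V : finType) (G : graph V) : bool :=
  [forall x in vset G, forall y in vset G, connect (adj G) x y].

(* For an irreflexive symmetric relation, the duplicate-free cyclic sequences
   of length at most 2 are the empty one and the edges traversed back and
   forth; a cycle of the graph has length at least 3. *)
Definition acyclic (V : finType) (G : graph V) : Prop :=
  forall c : seq V, ucycle (adj G) c -> size c <= 2.

Definition tree (V : finType) (G : graph V) : Prop :=
  [/\ is_graph G, vset G != set0, connected G & acyclic G].

Definition subgraph (V : finType) (H G : graph V) : bool :=
  [&& is_graph H, vset H \subset vset G & eset H \subset eset G].

Definition subtree (V : finType) (S T : graph V) : bool :=
  [&& subgraph S T, vset S != set0 & connected S].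

(* The vertex of a one-vertex graph counts as a leaf. *)
Definition leaf (V : finType) (G : graph V) (x : V) : bool :=
  (x \in vset G) && ((deg G x == 1) || (nverts G == 1)).

Definition single (V : finType) (v : V) : graph V := ([set v], set0).

Definition subtrees_over (V : finType) (T S : graph V) : {set graph V} :=
  [set H : graph V | subtree H T & subgraph S H].

Definition numN (V : finType) (T S : graph V) : nat := #|subtrees_over T S|.

Definition sumR (V : finType) (T S : graph V) : nat :=
  \sum_(H in subtrees_over T S) nverts H.

Definition mu (V : finType) (T S : graph V) : rat :=
  ((sumR T S)%:R / (numN T S)%:R)%R.

(* P is the vertex set of a path of G. *)
Definition path_set (V : finType) (G : graph V) (P : {set V}) : bool :=
  [exists p : #|P|.-tuple V,
     [&& P == [set x in p], uniq p & sorted (adj G) p]].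

(* Vertex sets of the paths made of leaves (at least one) and vertices of
   degree 2. When T is not a path, such a path contains exactly one leaf;
   allowing two makes the whole of T a limb when T is a path. *)
Definition limb_path (V : finType) (T : graph V) (P : {set V}) : bool :=
  [&& path_set T P, [exists x in P, leaf T x] &
      [forall x in P, leaf T x || (deg T x == 2)]].

Definition limb (V : finType) (T : graph V) (P : {set V}) : bool :=
  maxset (limb_path T) P.

Definition del_vertices (V : finType) (G : graph V) (A : {set V}) : graph V :=
  (vset G :\: A, [set p in eset G | (p.1 \notin A) && (p.2 \notin A)]).

Definition core (V : finType) (T : graph V) : graph V :=
  del_vertices T (\bigcup_(P : {set V} | limb T P) P).

(* Main.v *)
Require Import Defs.
From mathcomp Require Import all_boot all_order all_algebra.
From mathcomp Require Import zify ring lra.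

Set Implicit Arguments.
Unset Strict Implicit.
Unset Printing Implicit Defensive.

Import Order.TTheory GRing.Theory Num.Theory.

(** A subtree of a tree [T] is determined by its vertex set, so the local mean
    of [S] is an average over the connected vertex sets containing [S].  Encode
    a family of sets by its generating polynomial, the sum of ['X^#|H|]; the
    mean size is then the logarithmic derivative at [1].

    Every edge [pc] of [T] is a bridge.  Let [branch c p] be the side of [c]
    once [pc] is deleted, and let [C] be the generating polynomial of the
    connected sets containing [c] but not [p].  A connected set through [p]
    splits along the bridge, so generating polynomials factor with a factor
    [1 + C].  If [x] is a leaf of [S] with neighbour [q] in [S], and [c] is a
    vertex outside [S] adjacent to a vertex [p <> x] of [S], then [S] and
    [S - x + c] have generating polynomials [M X (1 + C)] and [M C (1 + X)] with
    the same [M].  Hence the sign of the change of the mean when [x] is traded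
    for [c] compares two numbers, each attached to one branch: the gaps
    [mean C - mean (1 + C) = R / (N (N + 1))], where [N] counts the connected
    sets and [R] sums their sizes ([mean_swap], [set_mean_swap]).

    The gap of a branch is at most [1 / 2], since the sets of the family take
    all sizes from [1] up to the largest one; equality means that no two of
    them have the same size ([sum_sizes], [branch_gap_bound]), which forces the
    branch to be a path ending in a leaf of [T], that is, part of a limb
    ([branch_path], [branch_not_core]).  Adding a stem below a branch can
    only bring its gap closer to [1 / 2] ([gap_stem]).

    If the mean at [S] is minimal, a leaf of [S] can only be traded for a vertex
    of larger or equal gap.  With two leaves [x], [y] of degree at most 2 in
    [T], trading each of them for the vertex beyond the other gives a cycle of
    inequalities, so that all these gaps are [1 / 2] ([branch_gap_two_ends]).
    Trading [x] then shows that every branch hanging off [S] at another vertex has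
    gap [1 / 2] as well, while what hangs at [x] lies in the branch of [x].  So
    everything outside [S], and [x] too, lies on limbs: the core is a subset of
    [S - x], and has fewer vertices than [S] ([minimal_not_core],
    [minimal_two_leaves]).  A single vertex of degree at most 2 is treated in
    the same way, playing the role of both leaves.  Finally
    a subtree with at least two vertices has two leaves, so that one of them has
    degree at least 3. *)

(** * Sums of sizes *)

(** Remove an element of largest size [g i]: since all smaller sizes occur
    among the others, [g i] is at most the number of elements, and the bound
    [1 + 2 + ... + n] follows by induction.  Equality forces [g i = n] at each
    stage, hence distinct sizes. *)
Lemma sum_sizes (I : finType) (g : I -> nat) (F : {set I}) :
    {in F, forall i, 0 < g i} ->
    {in F, forall i m, 0 < m < g i -> exists2 j, j \in F & g j = m} ->
  [/\ 2 * \sum_(i in F) g i <= #|F| * #|F|.+1,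
      {in F, forall i, g i <= #|F|} &
      2 * \sum_(i in F) g i = #|F| * #|F|.+1 -> {in F &, injective g}].
Proof.
move: {2}(#|F|) (erefl #|F|) => n; elim: n F => [|n IHn] F Fn g_gt0 g_down.
  have -> : F = set0 by apply/eqP; rewrite -cards_eq0 Fn.
  by rewrite big_set0 cards0; split=> [|i|_ i j]; rewrite ?inE.
have [i0 Fi0] : exists i, i \in F by apply/card_gt0P; rewrite Fn.
have [i Fi i_max] : exists2 i, i \in F & {in F, forall j, g j <= g i}.
  by case: (arg_maxnP g Fi0) => i Fi i_max; exists i.
have Fi_n : #|F :\ i| = n by move: Fn; rewrite (cardsD1 i) Fi => -[].
have [| |le_sum le_g inj_g] := IHn (F :\ i) Fi_n.
- by move=> j /setD1P[_]; apply: g_gt0.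
- move=> j /setD1P[_ Fj] m /andP[m_gt0 ltm].
  have [|k Fk gk] := g_down j Fj m; first by rewrite m_gt0.
  exists k; rewrite // !inE Fk andbT; apply: contraTneq ltm => ki.
  by rewrite -leqNgt -gk ki i_max.
have g_i : g i <= n.+1.
  have [//|lt_n] := leqP (g i) n.+1.
  have [j Fj gj] := g_down i Fi n.+1 lt_n.
  have : g j <= n.
    by rewrite -Fi_n le_g // !inE Fj andbT; apply: contraTneq lt_n => <-; rewrite gj ltnn.
  by rewrite gj ltnn.
have le_F : {in F, forall j, j != i -> g j <= n}.
  by move=> j Fj ji; rewrite -Fi_n le_g // !inE ji.
rewrite (big_setD1 i) //= Fn; rewrite Fi_n in le_sum inj_g.
split; first by nia.
  by move=> j Fj; case: (eqVneq j i) => [-> //|ji]; rewrite ltnW // ltnS le_F.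
move=> eq_sum; have gi_n : g i = n.+1 by nia.
have inj' : {in F :\ i &, injective g} by apply: inj_g; nia.
move=> j k Fj Fk; case: (eqVneq j i) (eqVneq k i) => [-> | ji] [-> | ki] // gjk.
- by have := le_F k Fk ki; rewrite -gjk gi_n ltnn.
- by have := le_F j Fj ji; rewrite gjk gi_n ltnn.
by apply: inj' => //; rewrite !inE ?ji ?ki.
Qed.

(** * Means of generating functions *)

Section Generating_functions.

Local Open Scope ring_scope.

(** For the generating polynomial of a family of sets by size, the average size
    of its members. *)
Definition mean (P : {poly rat}) : rat := P^`().[1] / P.[1].

(** How much the mean drops when the empty set is added to the family. *)
Definition gap (P : {poly rat}) : rat := mean P - mean (1 + P).

Lemma mean_mul P Q : 0 < P.[1] -> 0 < Q.[1] -> mean (P * Q) = mean P + mean Q.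
Proof.
move=> P_gt0 Q_gt0; rewrite /mean derivM !hornerE.
by field; rewrite !gt_eqF.
Qed.

Lemma horner1D_gt0 (P : {poly rat}) : 0 < P.[1] -> 0 < (1 + P).[1].
Proof. by move=> P_gt0; rewrite !hornerE; lra. Qed.

Lemma gapE (P : {poly rat}) :
  0 < P.[1] -> gap P = P^`().[1] / (P.[1] * (P.[1] + 1)).
Proof.
move=> P_gt0; rewrite /gap /mean derivD derivC add0r !hornerE.
by field; apply/andP; split; apply: lt0r_neq0 => //; lra.
Qed.

(** The two polynomials belong to a subtree and to the subtree obtained from it
    by trading a leaf, whose branch is counted by [X], for a new vertex, whose
    branch is counted by [C]: a branch contributes the factor [X] if its root
    is imposed and [1 + X] if it is optional. *)
Lemma mean_swap (M X C : {poly rat}) :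
    0 < M.[1] -> 0 < X.[1] -> 0 < C.[1] ->
  (mean (M * X * (1 + C)) <= mean (M * C * (1 + X))) = (gap X <= gap C).
Proof.
move=> M0 X0 C0; have [X1 C1] := (horner1D_gt0 X0, horner1D_gt0 C0).
have MX0 : 0 < (M * X).[1] by rewrite hornerM mulr_gt0.
have MC0 : 0 < (M * C).[1] by rewrite hornerM mulr_gt0.
rewrite !mean_mul // /gap; apply/idP/idP; lra.
Qed.

Lemma gapX : gap 'X = 1 / 2%:R.
Proof. by rewrite gapE ?derivX !hornerE. Qed.

(** ['X * (1 + B)] counts the family of a branch made of a new root below the
    branch of [B].  The difference of the two gaps is
    [(N (N + 1) - 2 R) / (N (N + 1) (N + 2))], whose sign is that of
    [1 / 2 - gap B]. *)
Lemma gap_stem (B : {poly rat}) :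
    0 < B.[1] -> gap B <= 1 / 2%:R ->
  gap B <= gap ('X * (1 + B)) /\
  (gap ('X * (1 + B)) <= gap B -> gap B = 1 / 2%:R).
Proof.
move=> B0; have X0 : 0 < ('X * (1 + B)).[1] by rewrite !hornerE; lra.
have XE : ('X * (1 + B)).[1] = B.[1] + 1 by rewrite !hornerE addrC.
have X'E : ('X * (1 + B))^`().[1] = B.[1] + 1 + B^`().[1].
  rewrite derivM derivX derivD derivC add0r !(hornerD, hornerM, hornerX, hornerC).
  ring.
rewrite !gapE ?XE ?X'E; [|lra|by []].
set N := B.[1] in B0 *; set R := (B^`()).[1].
have N1 : 0 < N + 1 by lra.
have N2 : 0 < N + 1 + 1 by lra.
have NN : 0 < N * (N + 1) by rewrite mulr_gt0.
rewrite ler_pdivrMr // => leR.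
have diff : (N + 1 + R) / ((N + 1) * (N + 1 + 1)) - R / (N * (N + 1)) =
   (N * (N + 1) - 2%:R * R) / (N * (N + 1) * (N + 1 + 1)).
  by field; rewrite !gt_eqF.
have D0 : 0 < N * (N + 1) * (N + 1 + 1) by rewrite mulr_gt0.
split.
  by rewrite -subr_ge0 diff divr_ge0 ?(ltW D0) //; lra.
rewrite -subr_le0 diff pmulr_lle0 ?invr_gt0 // => ge0.
have -> : R = N * (N + 1) / 2%:R by lra.
by field; rewrite !gt_eqF.
Qed.

End Generating_functions.

Section Generating_functions_of_sets.

Variable V : finType.
Implicit Types (F : {set {set V}}) (L : {set V}).

Definition gf (F : {set {set V}}) : {poly rat} := (\sum_(H in F) 'X^#|H|)%R.

(** Cutting the sets along [L] identifies [F] with the product of [F1] and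
    [F2]. *)
Lemma gf_mul L F F1 F2 :
    (forall H, (H \in F) = (H :\: L \in F1) && (H :&: L \in F2)) ->
    (forall A, A \in F1 -> [disjoint A & L]) ->
    (forall D, D \in F2 -> D \subset L) ->
  gf F = (gf F1 * gf F2)%R.
Proof.
move=> FE F1L F2L; rewrite /gf big_distrlr pair_big /=.
have key A D : A \in F1 -> D \in F2 -> (A :|: D) :\: L = A /\ (A :|: D) :&: L = D.
  move=> /F1L /disjoint_setI0 AL /F2L sDL.
  rewrite setDUl setIUl AL set0U (setIidPl sDL); split=> //.
  move: sDL; rewrite -setD_eq0 => /eqP->; rewrite setU0.
  by apply/setDidPl; rewrite -setI_eq0 AL.
rewrite (reindex_onto (fun H => (H :\: L, H :&: L)) (fun P => P.1 :|: P.2)) /=; last first.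
  by case=> A D /= /andP[/key kA /kA[-> ->]].
apply: eq_big => [H | H _]; first by rewrite FE setUC setID eqxx andbT.
by rewrite -exprD -{1}(cardsID L H) addnC.
Qed.


Lemma gf_horner1 F : ((gf F).[1] = #|F|%:R)%R.
Proof.
rewrite /gf horner_sum (eq_bigr (fun=> 1%R)) ?sumr_const // => H _.
by rewrite hornerXn expr1n.
Qed.

Lemma gf_deriv_horner1 F : ((gf F)^`().[1] = (\sum_(H in F) #|H|)%:R)%R.
Proof.
rewrite /gf raddf_sum horner_sum natr_sum; apply: eq_bigr => H _.
by rewrite /= derivXn hornerMn hornerXn expr1n.
Qed.

Lemma gf_gt0 F H : H \in F -> (0 < (gf F).[1])%R.
Proof.
by move=> FH; rewrite gf_horner1 ltr0n; apply/card_gt0P; exists H.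
Qed.

Lemma gap_gf_le F :
    F != set0 -> set0 \notin F ->
    {in F, forall (A : {set V}) m, 0 < m < #|A| -> exists2 B, B \in F & #|B| = m} ->
  (gap (gf F) <= 1 / 2%:R)%R /\
  (gap (gf F) = 1 / 2%:R -> {in F &, forall A B : {set V}, #|A| = #|B| -> A = B})%R.
Proof.
case/set0Pn=> H FH n0 F_down; rewrite gapE ?(gf_gt0 FH) //.
rewrite gf_horner1 gf_deriv_horner1 natr1 -natrM.
have N0 : 0 < #|F| by apply/card_gt0P; exists H.
have D0 : (0 < (#|F| * #|F|.+1)%:R :> rat)%R by rewrite ltr0n muln_gt0 N0.
have [|le_sum _ inj] := @sum_sizes _ (fun A : {set V} => #|A|) F _ F_down.
  by move=> A FA; rewrite card_gt0; apply: contraNneq n0 => <-.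
split.
  rewrite ler_pdivrMr // mul1r ler_pdivlMl ?ltr0n // -natrM ler_nat //.
move/eqP; rewrite eqr_div ?lt0r_neq0 // mul1r -natrM eqr_nat => /eqP E.
by apply: inj; rewrite mulnC.
Qed.

End Generating_functions_of_sets.

(** * Connected sets of vertices *)

Section Connected_sets.

Variables (V : finType) (e : rel V).
Hypothesis e_sym : symmetric e.
Implicit Types A B D H L S U W : {set V}.

Definition within (A : {set V}) : rel V :=
  fun x y => [&& x \in A, y \in A & e x y].

Definition conn (A : {set V}) : bool :=
  [forall x in A, forall y in A, connect (within A) x y].

Lemma within_sym (A : {set V}) : symmetric (within A).
Proof. by move=> x y; rewrite /within e_sym andbCA. Qed.

Lemma connect_within_sym (A : {set V}) : connect_sym (within A).
Proof. by apply: sym_connect_sym; apply: within_sym. Qed.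

Lemma connP (A : {set V}) :
  reflect {in A &, forall x y, connect (within A) x y} (conn A).
Proof.
apply: (iffP idP) => [/forall_inP cA x y Ax Ay | cA].
  by move/forall_inP: (cA x Ax); apply.
by apply/forall_inP=> x Ax; apply/forall_inP=> y Ay; apply: cA.
Qed.

Lemma connect_step_ind (r : rel V) (P : pred V) x y :
    (forall u v, r u v -> P u -> P v) -> connect r x y -> P x -> P y.
Proof.
move=> stepP /connectP[s]; elim: s x => [|z s IHs] x /=; first by move=> _ ->.
by case/andP=> rxz rs ys Px; apply: (IHs z rs ys); apply: (stepP x).
Qed.

Lemma conn_ind (A : {set V}) (P : pred V) c :
    conn A -> c \in A -> P c ->
    (forall u v, u \in A -> v \in A -> e u v -> P u -> P v) ->
  {in A, forall z, P z}.
Proof.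
move=> /connP cA Ac Pc stepP z Az; apply: connect_step_ind (cA c z Ac Az) Pc.
by move=> u v /and3P[]; apply: stepP.
Qed.

Lemma connect_withinS (A B : {set V}) x y :
  A \subset B -> connect (within A) x y -> connect (within B) x y.
Proof.
move=> sAB; apply: connect_sub => u v /and3P[Au Av euv].
by apply: connect1; rewrite /within !(subsetP sAB _ _, euv).
Qed.


Lemma conn_from c (A : {set V}) : {in A, forall z, connect (within A) c z} -> conn A.
Proof.
move=> cA; apply/connP => x y Ax Ay.
by apply: connect_trans (cA y Ay); rewrite connect_within_sym cA.
Qed.

Lemma conn1 x : conn [set x].
Proof. by apply/connP=> y z /set1P-> /set1P->. Qed.

Lemma connU A D p c :
  conn A -> conn D -> p \in A -> c \in D -> e p c -> conn (A :|: D).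
Proof.
move=> /connP cA /connP cD Ap Dc epc; apply: (@conn_from p) => z.
case/setUP=> [Az | Dz]; first exact: connect_withinS (subsetUl _ _) (cA _ _ Ap Az).
apply: (@connect_trans _ _ c).
  by apply: connect1; rewrite /within !inE Ap Dc orbT epc.
exact: connect_withinS (subsetUr _ _) (cD _ _ Dc Dz).
Qed.

(** Following a walk inside [H] between two points of [L], the only door out of
    [L] is [r]; hence the part of the walk outside [L] is a detour from [r] to
    [r] and can be cut out. *)
Lemma conn_door H L r :
    (forall u v, u \in H -> v \in H -> u \in L -> v \notin L -> e u v -> u = r) ->
  conn H -> conn (H :&: L).
Proof.
move=> door cH.
have [all_r | some_nr] := boolP [forall z in H :&: L, connect (within (H :&: L)) r z].
  by apply: (@conn_from r) => z HLz; apply: (forall_inP all_r).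
case/forall_inPn: some_nr => z HLz nrz; have [Hz _] := setIP HLz.
(* the component of z in H :&: L misses the door, so it is all of H *)
apply: (@conn_from z) => w /setIP[Hw _].
pose P w := (w \in H :&: L) && connect (within (H :&: L)) z w.
suff /andP[]: P w by [].
apply: (conn_ind cH Hz _ _ Hw); first by rewrite /P HLz connect0.
move=> u v Hu Hv euv /andP[HLu zu]; have [_ Lu] := setIP HLu.
have Lv: v \in L.
  apply: contraNT nrz => nLv.
  by rewrite connect_within_sym -(door u v).
have HLv: v \in H :&: L by rewrite inE Hv.
rewrite /P HLv; apply: connect_trans zu (connect1 _).
by rewrite /within HLu HLv.
Qed.


(** * Branches of a tree *)

Hypothesis e_irr : irreflexive e.
Hypothesis e_acyc : forall s : seq V, ucycle e s -> size s <= 2.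

Definition cut (c p : V) : rel V :=
  fun x y => e x y && ((x, y) \notin [:: (c, p); (p, c)]).

Definition branch (c p : V) : {set V} := [set z | connect (cut c p) c z].

Lemma branch_root c p : c \in branch c p.
Proof. by rewrite inE connect0. Qed.

Lemma branch_step c p u v :
  u \in branch c p -> e u v -> v \in branch c p \/ u = c /\ v = p.
Proof.
rewrite !inE => cu euv; case: (boolP (cut c p u v)) => [cuv | ].
  by left; apply: connect_trans cu (connect1 cuv).
rewrite /cut euv negbK !inE !xpair_eqE => /orP[] /andP[/eqP-> /eqP->].
  by right.
by left; apply: connect0.
Qed.

(** A path from [c] to [p] avoiding the edge [pc] would close up with that edge
    into a cycle of length at least 3. *)
Lemma bridge c p : e p c -> p \notin branch c p.
Proof.
move=> epc; rewrite inE; apply/negP => /connectP[s0].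
case/shortenP=> s ps us _ lps.
have eps : path e c s by apply: sub_path ps => x y /andP[].
have: size (c :: s) <= 2.
  by apply: e_acyc; rewrite /ucycle us /= rcons_path eps -lps epc.
case: s ps lps {us eps} => [|y [|]] //=; first by move=> _ cp; rewrite cp e_irr in epc.
by rewrite andbT => cy py _; rewrite py /cut !inE eqxx andbF in cy.
Qed.

Lemma conn_branch c p : conn (branch c p).
Proof.
apply: (@conn_from c) => z; rewrite {1}inE => cz.
pose P z := (z \in branch c p) && connect (within (branch c p)) c z.
suff /andP[]: P z by [].
apply: connect_step_ind cz _; last by rewrite /P branch_root connect0.
move=> u v cuv /andP[bu cu].
have bv: v \in branch c p.
  by rewrite !inE in bu *; apply: connect_trans bu (connect1 cuv).
rewrite /P bv; apply: connect_trans cu (connect1 _).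
by rewrite /within bu bv; case/andP: cuv.
Qed.

Lemma branch_conn D c p : conn D -> c \in D -> p \notin D -> D \subset branch c p.
Proof.
move=> cD Dc nDp; apply/subsetP.
apply: (conn_ind cD Dc (branch_root c p)) => u v Du Dv euv /branch_step-/(_ _ euv)[] //.
by case=> _ vp; rewrite -vp Dv in nDp.
Qed.

Lemma branch_disj A c p :
  e p c -> conn A -> p \in A -> c \notin A -> [disjoint A & branch c p].
Proof.
move=> epc cA Ap nAc; rewrite disjoint_subset; apply/subsetP.
apply: (conn_ind cA Ap (bridge epc)) => u v Au Av euv.
apply: contra => /branch_step-/(_ u); rewrite e_sym => /(_ euv)[] // [vc _].
by rewrite vc (negPf nAc) in Av.
Qed.

(** A connected set through [p] restricts to a connected set on either side of
    the bridge [pc]: leaving the side of [p] is possible only from [p], and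
    leaving the side of [c] only from [c]. *)
Lemma conn_split_out H c p :
  e p c -> conn H -> conn (H :\: branch c p).
Proof.
move=> epc; rewrite setDE; apply: (conn_door (r := p)) => u v _ _.
rewrite !inE negbK => nu vbr euv.
have /branch_step : v \in branch c p by rewrite inE.
move/(_ u); rewrite e_sym => /(_ euv)[|[]//].
by rewrite inE (negPf nu).
Qed.

Lemma conn_split_in H c p :
  e p c -> conn H -> conn (H :&: branch c p).
Proof.
move=> epc; apply: (conn_door (r := c)) => u v _ _ ubr nvbr euv.
by case: (branch_step ubr euv) => [|[]//]; rewrite (negPf nvbr).
Qed.

Lemma branch_sub p c z : e p c -> e c z -> z != p -> branch z c \subset branch c p.
Proof.
move=> epc ecz zp.
have sb : c |: branch z c \subset branch c p.
  apply: branch_conn; rewrite ?setU11 //.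
    by apply: connU (conn1 c) (conn_branch z c) _ (branch_root z c) ecz; rewrite inE.
  rewrite !inE negb_or.
  have -> /= : p != c by apply: contraTneq epc => ->; rewrite e_irr.
  have cpc : conn [set p; c] by apply: connU epc; rewrite ?conn1 ?inE.
  have zcp : z \notin [set p; c].
    by rewrite !inE (negPf zp); apply: contraTneq ecz => ->; rewrite e_irr.
  have dj : [disjoint [set p; c] & branch z c] by rewrite branch_disj // !inE eqxx orbT.
  by have := disjointFr dj (set21 p c); rewrite inE => ->.
by apply: subset_trans sb; apply: subsetUr.
Qed.

(** Induction on a directed edge, from the leaves inwards: the branches beyond
    [c] are strictly smaller than the branch at [c]. *)
Lemma branch_ind (P : V -> V -> Prop) :
    (forall p c, e p c -> (forall z, e c z -> z != p -> P c z) -> P p c) ->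
  forall p c, e p c -> P p c.
Proof.
move=> stepP p c; move: {2}(#|_|) (leqnn #|branch c p|) => n.
elim: n p c => [|n IHn] p c.
  by rewrite leqn0 cards_eq0 => /eqP b0; have := branch_root c p; rewrite b0 inE.
move=> brn epc; apply: stepP => // z ecz zp; apply: IHn => //.
rewrite -ltnS; apply: leq_trans brn; apply: proper_card; apply/properP.
by split; [apply: branch_sub | exists c; rewrite ?branch_root ?bridge].
Qed.

Lemma branch_cover (S : {set V}) u z :
    u \in S -> connect e u z ->
  z \in S \/ exists p c, [/\ p \in S, c \notin S, e p c & z \in branch c p].
Proof.
move=> Su uz.
pose P z := (z \in S) || [exists p, exists c, [&& p \in S, c \notin S, e p c & z \in branch c p]].
suff /orP[->|/existsP[p /existsP[c /and4P[]]]] : P z by [left | right; exists p, c].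
apply: connect_step_ind uz _; last by rewrite /P Su.
move=> x y exy; rewrite /P; have [//|nSy] := boolP (y \in S).
case/orP=> [Sx | /existsP[p /existsP[c /and4P[Sp nSc epc xbr]]]] /=.
  by apply/existsP; exists x; apply/existsP; exists y; rewrite Sx nSy exy branch_root.
apply/existsP; exists p; apply/existsP; exists c; rewrite Sp nSc epc /=.
by case: (branch_step xbr exy) => // [[_ yp]]; rewrite yp Sp in nSy.
Qed.

(** * Splitting along a bridge *)

Definition fam U W : {set {set V}} :=
  [set H | [&& conn H, U \subset H & [disjoint W & H]]].

Lemma disjoint1U (x : V) W H : [disjoint x |: W & H] = (x \notin H) && [disjoint W & H].
Proof. by rewrite -setI_eq0 setIUl setU_eq0 !setI_eq0 disjoints1. Qed.

Lemma mem_fam U W H :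
  (H \in fam U W) = [&& conn H, U \subset H & [disjoint W & H]].
Proof. by rewrite inE. Qed.

Lemma mem_fam11 c p H : (H \in fam [set c] [set p]) = [&& conn H, c \in H & p \notin H].
Proof. by rewrite inE sub1set disjoints1. Qed.

(** Cutting a set along the bridge [pc] gives two independent pieces, one
    through [p] and one through [c]; since [U] and [W] lie on the side of [p],
    their constraints bear on the first piece only. *)
Lemma gf_fam_with p c U W :
    e p c -> p \in U -> [disjoint U & branch c p] -> [disjoint W & branch c p] ->
  gf (fam (c |: U) W) = (gf (fam U (c |: W)) * gf (fam [set c] [set p]))%R.
Proof.
move=> epc Up UL WL; apply: (gf_mul (L := branch c p)) => [H | A | D].
- rewrite mem_fam11 !mem_fam disjoint1U !(in_setD, in_setI) branch_root.
  rewrite !andbT (negPf (bridge epc)) andbF !andbT /= subUset sub1set.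
  rewrite subsetD UL andbT.
  rewrite -[[disjoint W & H :\: _]]setI_eq0 setIDA -setIDAC (setDidPl WL) setI_eq0.
  apply/idP/idP => [/and3P[cH /andP[Hc sUH] WH] | ].
    by rewrite conn_split_out // conn_split_in // sUH WH Hc.
  case/andP=> /and3P[cA sUH WH] /andP[cD Hc]; rewrite sUH WH Hc !andbT.
  rewrite -[H](setID H (branch c p)) setUC; apply: (connU cA cD _ _ epc).
    by rewrite inE (subsetP sUH) // bridge.
  by rewrite inE Hc branch_root.
- rewrite inE disjoint1U => /and3P[cA sUA /andP[nAc _]].
  by apply: branch_disj; rewrite // (subsetP sUA).
by rewrite mem_fam11 => /and3P[]; apply: branch_conn.
Qed.

Lemma gf_fam p c U W :
    e p c -> p \in U -> [disjoint U & branch c p] -> [disjoint W & branch c p] ->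
  gf (fam U W) = (gf (fam U (c |: W)) * (1 + gf (fam [set c] [set p])))%R.
Proof.
move=> epc Up UL WL; rewrite mulrDr mulr1 -gf_fam_with // addrC.
rewrite /gf (bigID (fun H : {set V} => c \in H)) /=; congr (_ + _)%R; apply: eq_bigl => H.
  by rewrite !inE subUset sub1set -!andbA; do !bool_congr.
by rewrite !inE disjoint1U -!andbA; do !bool_congr.
Qed.

(** * The gap of a rooted family *)

(** Grow [B] from [c] one vertex at a time: as long as [B] is not all of [A],
    some edge of [A] leaves it. *)
Lemma conn_subset_size A c m :
    conn A -> c \in A -> 0 < m <= #|A| ->
  exists B : {set V}, [/\ conn B, c \in B, B \subset A & #|B| = m].
Proof.
move=> cA Ac; elim: m => // m IHm /= ltmA.
have [->|m_gt0] := posnP m.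
  by exists [set c]; rewrite conn1 set11 sub1set Ac cards1.
have [|B [cB Bc sBA Bm]] := IHm; first by rewrite m_gt0 ltnW.
have [x [y [Bx Ay nBy exy]]] : exists x y, [/\ x \in B, y \in A, y \notin B & e x y].
  have [/existsP[x /existsP[y /and4P[]]]|noxy] := boolP
    [exists x, exists y, [&& x \in B, y \in A, y \notin B & e x y]]; first by exists x, y.
  suff sAB : A \subset B by rewrite -Bm ltnNge subset_leq_card in ltmA.
  apply/subsetP; apply: (conn_ind (P := fun z => z \in B) cA Ac Bc) => u v _ Av euv Bu.
  apply: contraNT noxy => nBv; apply/existsP; exists u; apply/existsP; exists v.
  by rewrite Bu Av nBv.
exists (B :|: [set y]); split.
- by apply: connU (conn1 y) Bx _ exy; rewrite ?set11.
- by rewrite inE Bc.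
- by rewrite subUset sBA sub1set.
by rewrite setUC cardsU1 nBy Bm.
Qed.

Definition branch_gap c p : rat := gap (gf (fam [set c] [set p])).

Lemma edge_neq x y : e x y -> x != y.
Proof. by apply: contraTneq => ->; rewrite e_irr. Qed.

Lemma fam11_root p c : e p c -> [set c] \in fam [set c] [set p].
Proof. by move=> /edge_neq pc; rewrite mem_fam11 conn1 !inE eqxx. Qed.

Lemma branch_gap_bound p c : e p c ->
  (branch_gap c p <= 1 / 2%:R)%R /\
  (branch_gap c p = 1 / 2%:R ->
   {in fam [set c] [set p] &, forall A B : {set V}, #|A| = #|B| -> A = B})%R.
Proof.
move=> epc; apply: gap_gf_le.
- by apply/set0Pn; exists [set c]; apply: fam11_root.
- by rewrite mem_fam11 inE andbF.
move=> A; rewrite mem_fam11 => /and3P[cA Ac nAp] m /andP[m_gt0 ltmA].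
have [|B [cB Bc sBA <-]] := conn_subset_size (m := m) cA Ac.
  by rewrite m_gt0 ltnW.
by exists B; rewrite // mem_fam11 cB Bc; apply: contra nAp; apply: subsetP.
Qed.

Definition degree x := #|[set y | e x y]|.

(** If [c] had two neighbours [y], [z] other than [p], the sets [c, y] and
    [c, z] would have the same size.  So the branch continues in at most one
    way, and the family beyond [c] inherits the hypothesis by adding [c] to its
    members. *)
Lemma branch_path p c :
    e p c ->
    {in fam [set c] [set p] &, forall A B : {set V}, #|A| = #|B| -> A = B} ->
  exists s, [/\ path e c s, uniq (c :: s), branch c p =i c :: s,
                {in c :: s, forall z, degree z <= 2} & degree (last c s) = 1].
Proof.
move: p c; apply: branch_ind => p c epc IH inj.
have ecp : e c p by rewrite e_sym.
have npbr := bridge epc.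
have [z /andP[ecz zp] | noz] := pickP (fun z => e c z && (z != p)); last first.
  have nbr y : e c y -> y = p by move=> ecy; have := noz y; rewrite ecy => /negbFE/eqP.
  have dgc : degree c = 1.
    rewrite /degree (_ : [set y | _] = [set p]) ?cards1 //; apply/setP=> y; rewrite !inE.
    by apply/idP/eqP => [/nbr | ->].
  exists [::]; split=> // [y|y]; rewrite mem_seq1; last by move/eqP->; rewrite dgc.
  apply/idP/eqP => [ybr | ->]; last exact: branch_root.
  apply/eqP; apply: (conn_ind (conn_branch c p) (branch_root c p) (P := pred1 c)) ybr => //=.
  by move=> u v _ vbr euv /eqP uc; rewrite uc in euv; rewrite -{1}(nbr v euv) vbr in npbr.
have cp := edge_neq ecp; have cz := edge_neq ecz.
have nbr y : e c y -> y \in [set p; z].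
  move=> ecy; rewrite !inE; have [//|yp /=] := eqVneq y p.
  have cy := edge_neq ecy.
  have mem2 u : e c u -> u != p -> [set c; u] \in fam [set c] [set p].
    move=> ecu up; rewrite mem_fam11 !inE eqxx negb_or ![p == _]eq_sym cp up.
    by rewrite (connU (conn1 c) (conn1 u) _ _ ecu) ?set11.
  have := inj _ _ (mem2 y ecy yp) (mem2 z ecz zp); rewrite !cards2 cy cz => /(_ erefl).
  by move/setP/(_ y); rewrite !inE eqxx orbT eq_sym (negPf cy) => /esym.
have sbr := branch_sub epc ecz zp.
have ncbr := bridge ecz.
have fz D : D \in fam [set z] [set c] -> (c \notin D) /\ (c |: D \in fam [set c] [set p]).
  rewrite !mem_fam11 => /and3P[cD Dz nDc]; split=> //.
  rewrite (connU (conn1 c) cD _ Dz ecz) ?set11 // !inE eqxx negb_or [p == c]eq_sym cp /=.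
  by apply: contra npbr; apply: subsetP; apply: subset_trans sbr; apply: branch_conn.
have [D D' fD fD' DD'| s [ps us brE dgs dgl]] := IH z ecz zp.
  have [[cD FD] [cD' FD']] := (fz D fD, fz D' fD').
  rewrite -(setU1K cD) -(setU1K cD'); congr (_ :\ c).
  by apply: inj; rewrite ?cardsU1 ?cD ?cD' ?DD'.
have dgc : degree c = 2.
  rewrite /degree (_ : [set y | _] = [set p; z]) ?cards2 1?eq_sym ?zp //; apply/setP=> y.
  by rewrite inE; apply/idP/idP=> [/nbr // | /set2P[] ->].
exists (z :: s); split=> //.
- by rewrite /= ecz.
- by rewrite cons_uniq us andbT -brE.
- move=> y; rewrite in_cons -brE; apply/idP/idP; last first.
    by case/predU1P=> [-> | /(subsetP sbr)]; rewrite ?branch_root.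
  apply: (conn_ind (conn_branch c p) (branch_root c p) 
    (P := fun y => (y == c) || (y \in branch z c))).
    by rewrite eqxx.
  move=> u v _ vbr euv /predU1P[uc | ubr].
    rewrite uc in euv; case/set2P: (nbr v euv) => v_; first by rewrite -{1}v_ vbr in npbr.
    by rewrite v_ branch_root orbT.
  by case: (branch_step ubr euv) => [->|[_ ->]]; rewrite ?eqxx ?orbT.
move=> y /predU1P[->|]; [by rewrite dgc | exact: dgs].
Qed.

Lemma gf_fam_single x W :
  x \notin W -> (forall y, e x y -> y \in W) -> gf (fam [set x] W) = 'X%R.
Proof.
move=> nWx nbr; rewrite /gf (_ : fam _ _ = [set [set x]]) ?big_set1 ?cards1 ?expr1 //.
apply/setP=> H; rewrite mem_fam sub1set inE; apply/and3P/eqP => [[cH Hx WH] | ->].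
  apply/eqP; rewrite eqEsubset sub1set Hx andbT; apply/subsetP.
  apply: (conn_ind cH Hx); rewrite ?inE // => u v _ Hv euv /set1P ux.
  by rewrite ux in euv; rewrite (disjointFr WH (nbr v euv)) in Hv.
by rewrite conn1 set11 disjoint_sym disjoints1.
Qed.

(** A root of degree at most 2 has at most one branch above it; putting it
    below that branch can only bring the gap closer to [1 / 2]. *)
Lemma branch_gap_stem q x :
    e q x -> degree x <= 2 ->
  branch_gap x q = (1 / 2%:R)%R \/
  exists b, [/\ e x b, b != q, (branch_gap b x <= branch_gap x q)%R
              & (branch_gap x q <= branch_gap b x -> branch_gap b x = 1 / 2%:R)%R].
Proof.
move=> eqx dgx; have exq : e x q by rewrite e_sym.
have qx := edge_neq eqx.
have [b /andP[exb bq] | nob] := pickP (fun z => e x z && (z != q)); last first.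
  left; rewrite /branch_gap gf_fam_single ?gapX // ?inE 1?eq_sym // => y exy.
  by have := nob y; rewrite exy inE => /negbFE.
right; exists b; rewrite exb bq.
have xb := edge_neq exb.
have dgE : [set y | e x y] = [set q; b].
  apply/esym/eqP; rewrite eqEcard cards2 1?eq_sym bq dgx andbT.
  by apply/subsetP=> y /set2P[] ->; rewrite inE.
have gfE : gf (fam [set x] [set q]) = ('X * (1 + gf (fam [set b] [set x])))%R.
  have nqb : q \notin branch b x.
    by apply: contra (bridge eqx); apply: subsetP; apply: branch_sub.
  rewrite (gf_fam exb) ?set11 ?disjoints1 ?bridge //.
  rewrite gf_fam_single // => [|y exy]; first by rewrite !inE negb_or xb eq_sym.
  by rewrite setUC -dgE inE.
have [] := @gap_stem (gf (fam [set b] [set x])) (gf_gt0 (fam11_root exb))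
  (proj1 (branch_gap_bound exb)).
by rewrite -gfE.
Qed.

(** Write [X], [Y] for the gaps at [x], [y] and [B], [B'] for those of the
    branches above them.  When both branches exist,
    [X <= B' <= Y <= B <= X], and the equality case [X = B] of the previous
    lemma applies.  A missing branch gives the value [1 / 2] at once.  The
    vertices [x] and [y] may coincide. *)
Lemma branch_gap_two_ends x y q r :
    e q x -> e r y -> degree x <= 2 -> degree y <= 2 ->
    (forall b, e x b -> b != q -> (branch_gap y r <= branch_gap b x)%R) ->
    (forall b, e y b -> b != r -> (branch_gap x q <= branch_gap b y)%R) ->
  branch_gap x q = (1 / 2%:R)%R.
Proof.
move=> eqx ery dgx dgy yx xy.
have [//|[b [exb bq leb eqb]]] := branch_gap_stem eqx dgx.
have [leX _] := branch_gap_bound eqx; have leYb := yx b exb bq.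
have [Y|[b' [eyb b'r leb' _]]] := branch_gap_stem ery dgy; first by lra.
have leXb := xy b' eyb b'r.
have : branch_gap b x = (1 / 2%:R)%R by apply: eqb; lra.
by lra.
Qed.

(** * Moving a leaf *)

Definition set_mean S : rat := mean (gf (fam S set0)).

Lemma set_mean_swap1 x c :
  e x c -> (set_mean [set x] <= set_mean [set c])%R -> (branch_gap x c <= branch_gap c x)%R.
Proof.
move=> exc; have ecx : e c x by rewrite e_sym.
have fam0 y z : e y z -> gf (fam [set y] set0) =
    (gf (fam [set y] [set z]) * (1 + gf (fam [set z] [set y])))%R.
  move=> eyz; rewrite (gf_fam eyz) ?set11 ?disjoints1 ?bridge ?setU0 //.
  by rewrite -setI_eq0 set0I.
rewrite /set_mean (fam0 x c) // (fam0 c x) //.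
set X := gf _; set C := gf (fam [set c] _).
have := @mean_swap 1 X C; rewrite !mul1r => -> //.
- by rewrite hornerC.
- exact: gf_gt0 (fam11_root ecx).
exact: gf_gt0 (fam11_root exc).
Qed.

Lemma conn_del_leaf S q x :
    conn S -> q \in S -> (forall y, y \in S -> e x y -> y = q) -> conn (S :\ x).
Proof.
move=> cS Sq lx; rewrite setDE; apply: (conn_door (r := q)) cS => u v Su _ _.
by rewrite !inE negbK => /eqP-> eux; apply: lx; rewrite // e_sym.
Qed.

Lemma set_mean_swap S q x p c :
    conn S -> q \in S -> x \in S -> p \in S -> c \notin S ->
    e q x -> e p c -> p != x -> (forall y, y \in S -> e x y -> y = q) ->
    (set_mean S <= set_mean (c |: S :\ x))%R ->
  (branch_gap x q <= branch_gap c p)%R.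
Proof.
move=> cS Sq Sx Sp nSc eqx epc px lx.
set U := S :\ x; have cU : conn U := conn_del_leaf cS Sq lx.
have qx := edge_neq eqx.
have Uq : q \in U by rewrite !inE qx.
have Up : p \in U by rewrite !inE px.
have cx : c != x by apply: contraNneq nSc => ->.
have cU' : conn (c |: U) by rewrite setUC; apply: connU (conn1 c) Up _ epc; rewrite ?set11.
have dS : [disjoint S & branch c p] by apply: branch_disj.
have dU' : [disjoint c |: U & branch x q].
  apply: branch_disj => //; first by rewrite in_setU Uq orbT.
  by rewrite !inE eqxx orbF eq_sym.
have dU : [disjoint U & branch c p] by apply: disjointWl dS; apply: subD1set.
have dUx : [disjoint U & branch x q] by apply: disjointWl dU'; apply: subsetUr.
have d0 W : [disjoint set0 & W] by rewrite -setI_eq0 set0I.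
have dc : [disjoint [set c] & branch x q] by apply: disjointWl dU'; rewrite subsetUl.
have dx : [disjoint [set x] & branch c p] by apply: disjointWl dS; rewrite sub1set.
have SE : S = x |: U by rewrite setD1K.
have -> : set_mean S = mean (gf (fam U [set x; c]) * gf (fam [set x] [set q]) *
                            (1 + gf (fam [set c] [set p])))%R.
  rewrite /set_mean (gf_fam epc Sp dS (d0 _)) setU0 [X in fam X]SE.
  by rewrite (gf_fam_with eqx Uq dUx dc).
have -> : set_mean (c |: U) = mean (gf (fam U [set x; c]) * gf (fam [set c] [set p]) *
                            (1 + gf (fam [set x] [set q])))%R.
  rewrite /set_mean (gf_fam eqx _ dU' (d0 _)) ?in_setU ?Uq ?orbT // setU0.
  by rewrite (gf_fam_with epc Up dU dx) [c |: _]setUC.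
rewrite mean_swap //.
- apply: (@gf_gt0 _ _ U); rewrite mem_fam cU subxx disjoint1U disjoints1.
  by rewrite !inE eqxx (negPf nSc) andbF.
- exact: gf_gt0 (fam11_root eqx).
exact: gf_gt0 (fam11_root epc).
Qed.

(** Walk away from the edge [qx] inside [S] for as long as possible. *)
Lemma branch_leaf (S : {set V}) q x :
    e q x -> q \in S -> x \in S ->
  exists l r, [/\ l \in S, r \in S, e r l, l \in branch x q
                & forall y, y \in S -> e l y -> y = r].
Proof.
move: q x; apply: branch_ind => q x eqx IH Sq Sx.
have [z /and3P[exz zq Sz] | noz] := pickP (fun z => [&& e x z, z != q & z \in S]).
  have [l [r [Sl Sr erl lbr lr]]] := IH z exz zq Sx Sz.
  by exists l, r; split=> //; apply: (subsetP (branch_sub eqx exz zq)).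
exists x, q; split; rewrite ?branch_root // => y Sy exy.
by have := noz y; rewrite exy Sy andbT => /negbFE/eqP.
Qed.

(** The two sides of any edge of [S] each contain a leaf of [S]. *)
Lemma two_leaves S :
    conn S -> 1 < #|S| ->
  exists x q y r, [/\ x != y, [/\ x \in S, q \in S, e q x & forall z, z \in S -> e x z -> z = q]
                & [/\ y \in S, r \in S, e r y & forall z, z \in S -> e y z -> z = r]].
Proof.
move=> cS S_gt1.
have [a Sa] : exists a, a \in S by apply/card_gt0P; apply: ltnW.
have [|B [cB Ba sBS /eqP/cards2P[b [d [bd BE]]]]] := conn_subset_size (m := 2) cS Sa.
  exact: S_gt1.
have Sb : b \in S by apply: (subsetP sBS); rewrite BE set21.
have Sd : d \in S by apply: (subsetP sBS); rewrite BE set22.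
have ebd : e b d.
  move/connP: cB => /(_ b d); rewrite BE set21 set22 => /(_ isT isT).
  case/connectP=> [[|z s] /= ]; first by move=> _ db; rewrite db eqxx in bd.
  case/andP=> /and3P[_ /set2P[]-> ebz] _ _ //; by rewrite e_irr in ebz.
have edb : e d b by rewrite e_sym.
have [x [q [Sx Sq eqx xbr xq]]] := branch_leaf ebd Sb Sd.
have [y [r [Sy Sr ery ybr yr]]] := branch_leaf edb Sd Sb.
exists x, q, y, r; split=> //.
have dj : [disjoint branch b d & branch d b].
  by rewrite branch_disj ?conn_branch ?branch_root ?bridge.
by apply: contraTneq ybr => <-; rewrite (disjointFl dj).
Qed.

End Connected_sets.

(** * Subtrees as connected sets of vertices *)

Lemma adj_vset (V : finType) (G : graph V) x y :
  is_graph G -> adj G x y -> [/\ x \in vset G, y \in vset G, x != y & adj G y x].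
Proof. by move=> /forallP/(_ x)/forallP/(_ y)/implyP gG /gG/and4P. Qed.

Section Tree.

Variables (V : finType) (T : graph V).
Hypothesis treeT : tree T.

Let e := adj T.
Let graphT : is_graph T. Proof. by case: treeT. Qed.

Lemma adj_sym : symmetric e.
Proof. by move=> x y; apply/idP/idP=> /(adj_vset graphT)[]. Qed.

Lemma adj_irr : irreflexive e.
Proof. by move=> x; apply/negP=> /(adj_vset graphT)[]; rewrite eqxx. Qed.

Lemma adj_acyc s : ucycle e s -> size s <= 2.
Proof. by case: treeT => _ _ _; apply. Qed.

Lemma adj_conn x y : x \in vset T -> y \in vset T -> connect e x y.
Proof. by case: treeT => _ _ /forall_inP cT _ Tx; apply/forall_inP/cT. Qed.

Definition induced (A : {set V}) : graph V :=
  (A, [set p in eset T | (p.1 \in A) && (p.2 \in A)]).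

Lemma adj_induced A x y : adj (induced A) x y = [&& e x y, x \in A & y \in A].
Proof. by rewrite /adj inE. Qed.

Lemma conn_sub_vset (A : {set V}) x :
  conn e A -> x \in A -> x \in vset T -> A \subset vset T.
Proof.
move=> cA Ax Tx; apply/subsetP; apply: (conn_ind cA Ax Tx (P := mem (vset T))).
by move=> u v _ _ /(adj_vset graphT)[].
Qed.

Lemma subtree_induced (A : {set V}) :
  A \subset vset T -> A != set0 -> conn e A -> subtree (induced A) T.
Proof.
move=> sAT A0 /connP cA; apply/and3P; split=> //.
  apply/and3P; split=> //; last by apply/subsetP=> p; rewrite inE => /andP[].
  apply/forallP=> x; apply/forallP=> y; apply/implyP; rewrite !adj_induced.
  case/and3P=> /(adj_vset graphT)[_ _ -> eyx] Ax Ay.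
  by rewrite /= Ax Ay [e y x]eyx.
apply/forall_inP=> x Ax; apply/forall_inP=> y Ay.
apply: (connect_sub _ (cA x y Ax Ay)) => u v /and3P[Au Av euv].
by apply: connect1; rewrite adj_induced euv Au.
Qed.

(** A missing edge [xy] would be bypassed inside the subtree by a path of the
    tree that avoids it, but every edge of a tree is a bridge. *)
Lemma subtree_adj S x y :
  subtree S T -> adj S x y = [&& e x y, x \in vset S & y \in vset S].
Proof.
case/and3P=> /and3P[gS _ /subsetP sST] _ /forall_inP cS.
apply/idP/and3P=> [xy | [exy Sx Sy]].
  by have [-> -> _ _] := adj_vset gS xy; split=> //; exact: sST (x, y) xy.
apply: contraT => nxy.
have eyx : e y x by rewrite adj_sym.
have /negP[] := bridge adj_irr adj_acyc eyx.
rewrite inE; apply: connect_sub (forall_inP (cS x Sx) y Sy) => u v uv.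
apply: connect1; have euv : e u v := sST (u, v) uv.
rewrite /cut euv /= !inE !xpair_eqE.
apply: contra nxy => /orP[] /andP[/eqP ux /eqP vy]; rewrite -ux -vy //.
by have [] := adj_vset gS uv.
Qed.

Lemma subtree_conn S : subtree S T -> conn e (vset S).
Proof.
move=> tS; have /and3P[_ _ /forall_inP cS] := tS.
apply/connP=> x y Sx Sy; apply: connect_sub (forall_inP (cS x Sx) y Sy) => u v.
by rewrite subtree_adj // => /and3P[euv Su Sv]; apply: connect1; apply/and3P.
Qed.

Lemma subtree_vset_inj S S' : subtree S T -> subtree S' T -> vset S = vset S' -> S = S'.
Proof.
move=> tS tS' eqv; rewrite [S]surjective_pairing [S']surjective_pairing.
congr (_, _) => //; apply/setP=> -[x y].
by have := subtree_adj x y tS; rewrite eqv -subtree_adj.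
Qed.

Lemma fam_subtrees_over S :
  subtree S T -> fam e (vset S) set0 = [set vset H | H in subtrees_over T S].
Proof.
move=> tS; have /and3P[/and3P[gS sST _] /set0Pn[x Sx] _] := tS.
apply/setP=> A; rewrite mem_fam -setI_eq0 set0I eqxx andbT.
apply/andP/imsetP=> [[cA sSA] | [H]]; last first.
  rewrite inE => /andP[tH /and3P[_ sSH _]] ->; split=> //; exact: subtree_conn.
have Ax := subsetP sSA x Sx.
have tA : subtree (induced A) T.
  apply: (subtree_induced _ _ cA); first exact: conn_sub_vset cA Ax (subsetP sST x Sx).
  by apply/set0Pn; exists x.
exists (induced A) => //; rewrite inE tA /subgraph gS sSA /=.
apply/subsetP=> -[u v] uv.
have : adj S u v by []. 
rewrite subtree_adj // => /and3P[euv Su Sv].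
by rewrite inE /= !(subsetP sSA) // !andbT; exact: euv.
Qed.

Lemma mu_set_mean S : subtree S T -> mu T S = set_mean e (vset S).
Proof.
move=> tS; rewrite /mu /set_mean /mean gf_horner1 gf_deriv_horner1 fam_subtrees_over //.
have inj : {in subtrees_over T S &, injective (@vset V)}.
  by move=> H H'; rewrite !inE => /andP[tH _] /andP[tH' _]; apply: subtree_vset_inj.
by rewrite card_in_imset // big_imset.
Qed.

(** * Limbs *)

Lemma limb_path_not_core P z :
  limb_path T P -> z \in P -> z \notin vset (core T).
Proof.
move=> lP Pz; have [Q lQ sPQ] := maxset_exists lP.
rewrite inE negb_and negbK; apply/orP; left.
by apply/bigcupP; exists Q; rewrite ?(subsetP sPQ).
Qed.

(** A branch of gap [1 / 2] is a path that ends in a leaf and whose vertices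
    have degree at most 2, so that it is contained in a limb. *)
Lemma branch_not_core p c z :
    e p c -> branch_gap e c p = (1 / 2%:R)%R -> z \in branch e c p -> z \notin vset (core T).
Proof.
move=> epc gap_c; have [_ /(_ gap_c) inj] := branch_gap_bound adj_sym adj_irr epc.
have [s [ps us brE dgs dgl]] := branch_path adj_sym adj_irr adj_acyc epc inj.
pose P := [set y in c :: s].
have cT : c \in vset T by have [] := adj_vset graphT epc.
have sT : {in c :: s, forall y, y \in vset T}.
  move=> y; rewrite -brE.
  apply: (conn_ind (conn_branch _ _ _) (branch_root _ _ _) cT (P := mem (vset T))).
    exact: adj_sym.
  by move=> u v _ _ /(adj_vset graphT)[].
suff lP : limb_path T P by rewrite brE => sz; apply: limb_path_not_core lP _; rewrite inE.
have leafE y : y \in c :: s -> deg T y = 1 -> leaf T y.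
  by move=> sy dy; rewrite /leaf sT // dy.
apply/and3P; split.
- have Ps : size (c :: s) == #|P| by rewrite cardsE (card_uniqP us).
  by apply/existsP; exists (Tuple Ps); apply/and3P.
- apply/exists_inP; exists (last c s); first by rewrite inE mem_last.
  by apply: leafE; rewrite ?mem_last.
apply/forall_inP=> y; rewrite inE => sy.
have: deg T y <= 2 := dgs y sy.
have: 0 < deg T y.
  have [/eqP-> | yc] := boolP (y == c); apply/card_gt0P.
    by exists p; rewrite inE -/e adj_sym.
  have /connectP[] := adj_conn (sT y sy) cT.
  case=> [_ /= cy|w s' /= /andP[eyw _] _]; first by rewrite cy eqxx in yc.
  by exists w; rewrite inE.
case dy: (deg T y) => [|[|[|]]] // _ _; first by rewrite leafE.
by rewrite orbT.
Qed.

(** * Minimal subtrees *)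

(** Swaps are only available for an outside vertex [c] whose neighbour in [S]
    survives the removal of [x], or for [c = q] when [S] is the single vertex
    [x].  The remaining outside vertices hang at [x], inside [branch x q]. *)
Lemma minimal_not_core S x q :
    subtree S T -> x \in vset S -> e q x -> branch_gap e x q = (1 / 2%:R)%R ->
    (forall p c, p \in vset S -> c \notin vset S -> e p c -> p != x \/ c = q ->
       (branch_gap e x q <= branch_gap e c p)%R) ->
  vset (core T) \subset vset S :\ x.
Proof.
move=> tS Sx eqx gap_x swap; have /and3P[/and3P[_ /subsetP sST _] _ _] := tS.
apply/subsetP=> z core_z; rewrite inE in_set1.
have zT : z \in vset T by case/setDP: core_z.
have -> /= : z != x.
  by apply: contraTneq core_z => ->; apply: branch_not_core eqx gap_x (branch_root _ _ _).
have [//|[p [c [Sp nSc epc zbr]]]] := branch_cover Sx (adj_conn (sST x Sx) zT).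
have [pxcq | ] := boolP ((p != x) || (c == q)).
  have le_c : (branch_gap e x q <= branch_gap e c p)%R.
    by apply: swap => //; case/orP: pxcq => [|/eqP]; [left | right].
  have [le_half _] := branch_gap_bound adj_sym adj_irr epc.
  have gap_c : branch_gap e c p = (1 / 2%:R)%R by lra.
  by have := branch_not_core epc gap_c zbr; rewrite core_z.
rewrite negb_or negbK => /andP[/eqP px cq]; rewrite px in epc zbr.
have zbr' := subsetP (branch_sub adj_sym adj_irr adj_acyc eqx epc cq) z zbr.
by have := branch_not_core eqx gap_x zbr'; rewrite core_z.
Qed.

Lemma minimal_two_leaves S x q y r :
    subtree S T ->
    (forall A : {set V}, A \subset vset T -> conn e A -> #|A| = nverts S ->
       (set_mean e (vset S) <= set_mean e A)%R) ->
    x != y -> x \in vset S -> q \in vset S -> e q x ->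
    (forall z, z \in vset S -> e x z -> z = q) ->
    y \in vset S -> r \in vset S -> e r y ->
    (forall z, z \in vset S -> e y z -> z = r) ->
    deg T x <= 2 -> deg T y <= 2 ->
  nverts (core T) < nverts S.
Proof.
move=> tS minS xy Sx Sq eqx lx Sy Sr ery ly dx dy.
have cS := subtree_conn tS; have /and3P[/and3P[_ sST _] _ _] := tS.
have swap x' q' p c : x' \in vset S -> q' \in vset S -> e q' x' ->
    (forall z, z \in vset S -> e x' z -> z = q') ->
    p \in vset S -> c \notin vset S -> e p c -> p != x' -> 
    (branch_gap e x' q' <= branch_gap e c p)%R.
  move=> Sx' Sq' eqx' lx' Sp nSc epc px'.
  apply: (set_mean_swap adj_sym adj_irr adj_acyc cS) => //.
  apply: minS.
  - rewrite subUset sub1set (subset_trans (subD1set _ _) sST) andbT.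
    by have [] := adj_vset graphT epc.
  - rewrite setUC; apply: (connU adj_sym _ (conn1 e c) _ (set11 c) epc).
      exact: (conn_del_leaf adj_sym cS Sq' lx').
    by rewrite !inE px'.
  by rewrite cardsU1 !inE negb_and nSc orbT /nverts (cardsD1 x' (vset S)) Sx'.
have out x' q' b : (forall z, z \in vset S -> e x' z -> z = q') -> e x' b -> b != q' ->
    b \notin vset S.
  by move=> lx' exb; apply: contra => Sb; rewrite (lx' b).
have gap_x : branch_gap e x q = (1 / 2%:R)%R.
  apply: (branch_gap_two_ends adj_sym adj_irr adj_acyc eqx ery) => // [b exb bq|b eyb b_r].
    by apply: swap => //; apply: out lx exb bq.
  by apply: swap => //; [apply: out ly eyb b_r | rewrite eq_sym].
apply: (@leq_ltn_trans #|vset S :\ x|); last by rewrite /nverts (cardsD1 x (vset S)) Sx.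
apply: subset_leq_card; apply: (minimal_not_core tS Sx eqx gap_x) => p c Sp nSc epc.
by case=> [px | cq]; [apply: swap | rewrite cq Sq in nSc].
Qed.

(** Sliding the single vertex [v] along an edge is a trade between the two sides
    of that edge, so [v] acts as a leaf in each direction. *)
Lemma minimal_vertex_deg v :
    v \in vset T -> vset (core T) != set0 ->
    {in vset T, forall w, (set_mean e [set v] <= set_mean e [set w])%R} ->
  3 <= deg T v.
Proof.
move=> Tv core_n0 minv; rewrite leqNgt; apply/negP=> dv.
have tv : subtree (induced [set v]) T.
  apply: subtree_induced; rewrite ?sub1set ?conn1 //.
  by apply/set0Pn; exists v; rewrite inE.
have swap c : e v c -> (branch_gap e v c <= branch_gap e c v)%R.
  move=> evc; apply: (set_mean_swap1 adj_sym adj_irr adj_acyc evc); apply: minv.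
  by have [] := adj_vset graphT evc.
have sub_core q : e q v -> branch_gap e v q = (1 / 2%:R)%R -> False.
  move=> eqv gap_v.
  have := minimal_not_core tv (set11 v) eqv gap_v.
  rewrite /= setDv subset0 (negPf core_n0) => H; suff : false by []; apply: H.
  move=> p c /set1P-> _ evc [/eqP// | ->]; apply: swap.
  by rewrite adj_sym.
have [q evq | nov] := pickP (e v); last first.
  have TE : vset T = [set v].
    apply/eqP; rewrite eqEsubset sub1set Tv andbT; apply/subsetP=> z Tz.
    case/connectP: (adj_conn Tv Tz) => -[_ ->|w s /=]; first exact: set11.
    by rewrite nov.
  have lv : limb_path T [set v].
    have leafv : leaf T v by rewrite /leaf Tv /nverts TE cards1 orbT.
    have sz : size [:: v] == #|[set v]| by rewrite cards1.
    apply/and3P; split.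
    - apply/existsP; exists (Tuple sz); rewrite /= andbT; apply/eqP/setP=> z.
      by rewrite !inE.
    - by apply/exists_inP; exists v; rewrite ?set11.
    by apply/forall_inP=> z /set1P->; rewrite leafv.
  case/set0Pn: core_n0 => z core_z.
  have : z \in vset T by case/setDP: core_z.
  by rewrite TE => zv; have := limb_path_not_core lv zv; rewrite core_z.
have eqv : e q v by rewrite adj_sym.
have [r /andP[evr rq] | nor] := pickP (fun z => e v z && (z != q)); last first.
  apply: (sub_core q eqv).
  apply: (branch_gap_two_ends adj_sym adj_irr adj_acyc eqv eqv) => // b evb bq.
    by have := nor b; rewrite evb bq.
  by have := nor b; rewrite evb bq.
have erv : e r v by rewrite adj_sym.
have nbr b : e v b -> b = q \/ b = r.
  have /eqP qrE : [set q; r] == [set y | e v y].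
    rewrite eqEcard cards2 1?eq_sym rq andbC; apply/andP; split; first exact: dv.
    by apply/subsetP=> y /set2P[] ->; rewrite inE.
  by move=> evb; apply/set2P; rewrite qrE inE.
apply: (sub_core q eqv).
apply: (branch_gap_two_ends adj_sym adj_irr adj_acyc eqv erv) => // b evb bqr.
  by case: (nbr b evb) => bE; [rewrite bE eqxx in bqr | rewrite bE; apply: swap].
by case: (nbr b evb) => bE; [rewrite bE; apply: swap | rewrite bE eqxx in bqr].
Qed.

End Tree.

Theorem theorem5p1 (V : finType) (T : graph V)
    (treeT : tree T) (core_n0 : vset (core T) != set0) :
  (forall (k : nat) (S : graph V),
     subtree S T -> nverts S = k -> k <= nverts (core T) ->
     (forall S' : graph V,
        subtree S' T -> nverts S' = k -> (mu T S <= mu T S')%R) ->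
     #|[set v | leaf S v & deg T v <= 2]| <= 1 /\
     (exists v : V, leaf S v /\ 3 <= deg T v)) /\
  (forall v : V, v \in vset T ->
     (forall w : V, w \in vset T ->
        (mu T (single v) <= mu T (single w))%R) ->
     3 <= deg T v).
Proof.
have e_sym := adj_sym treeT; have e_irr := adj_irr treeT.
have single_sub v : v \in vset T -> subtree (single v) T.
  move=> Tv.
  have sE : single v = induced T [set v].
    congr (_, _); apply/setP=> -[x y]; rewrite !inE /=; apply/esym/negP.
    by case/and3P=> [exy /eqP xv /eqP yv]; have := e_irr v; rewrite /adj -{1}xv -yv exy.
  rewrite sE; apply: subtree_induced => //; rewrite ?sub1set ?conn1 //.
  by apply/set0Pn; exists v; rewrite inE.
have part2 v : v \in vset T ->
    (forall w, w \in vset T -> (mu T (single v) <= mu T (single w))%R) -> 3 <= deg T v.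
  move=> Tv minv; apply: (minimal_vertex_deg treeT Tv core_n0) => w Tw.
  by have := minv w Tw; rewrite !(mu_set_mean treeT) ?single_sub.
split=> // k S tS Sk le_k minS.
have /and3P[/and3P[_ sST _] S0 _] := tS.
have [S1 | S_gt1] := leqP (nverts S) 1.
  have {S0} /cards1P[v Sv] : nverts S == 1 by rewrite eqn_leq S1 card_gt0.
  have leafS w : leaf S w = (w == v) by rewrite /leaf /nverts Sv cards1 eqxx orbT andbT inE.
  have Tv : v \in vset T by rewrite (subsetP sST) // Sv set11.
  split.
    rewrite -(cards1 v); apply: subset_leq_card; apply/subsetP=> w.
    by rewrite !inE leafS => /andP[].
  exists v; split; first by rewrite leafS.
  apply: part2 => // w Tw.
  have <- : mu T S = mu T (single v).
    by rewrite !(mu_set_mean treeT) ?single_sub // Sv.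
  by apply: minS; rewrite ?single_sub // -Sk /nverts Sv !cards1.
have leafP v : leaf S v -> v \in vset S /\ exists q,
    [/\ q \in vset S, adj T q v & forall z, z \in vset S -> adj T v z -> z = q].
  case/andP=> Sv; rewrite (gtn_eqF S_gt1) orbF => /cards1P[q qE]; split=> //.
  have memq z : (z \in vset S) && adj T v z = (z == q).
    by move/setP/(_ z): qE; rewrite !inE (subtree_adj treeT _ _ tS) Sv andbC.
  have /andP[Sq evq] : (q \in vset S) && adj T v q by rewrite memq.
  exists q; split; rewrite // 1?e_sym // => z Sz evz.
  by apply/eqP; rewrite -memq Sz.
have le1 : #|[set v | leaf S v & deg T v <= 2]| <= 1.
  apply/card_le1P => x; rewrite inE => /andP[lx dx] y; rewrite !inE.
  apply/andP/eqP=> [[ly dy]|->]; last by [].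
  apply/eqP; apply: contraLR le_k; rewrite eq_sym -ltnNge -Sk => xy.
  have [Sx [q [Sq eqx xq]]] := leafP x lx; have [Sy [r [Sr ery yr]]] := leafP y ly.
  apply: (minimal_two_leaves treeT tS _ xy Sx Sq eqx xq Sy Sr ery yr dx dy).
  move=> A sAT cA Ak; have A0 : A != set0 by rewrite -card_gt0 Ak ltnW.
  have tA := subtree_induced treeT sAT A0 cA.
  by have := minS _ tA; rewrite !(mu_set_mean treeT) //; apply; rewrite -Sk -Ak.
split=> //.
have [x [q [y [r [xy [Sx Sq eqx xq] [Sy Sr ery yr]]]]]] :=
  two_leaves e_sym e_irr (adj_acyc treeT) (subtree_conn treeT tS) S_gt1.
have leafI v p : v \in vset S -> p \in vset S -> adj T p v ->
    (forall z, z \in vset S -> adj T v z -> z = p) -> leaf S v.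
  move=> Sv Sp epv lv; rewrite /leaf Sv; apply/orP; left; apply/cards1P; exists p.
  apply/setP=> z; rewrite !inE (subtree_adj treeT _ _ tS) Sv /=.
  apply/andP/eqP=> [[evz Sz]|->]; first exact: lv.
  by rewrite e_sym.
have lx := leafI x q Sx Sq eqx xq; have ly := leafI y r Sy Sr ery yr.
have [dx | dx] := leqP (deg T x) 2; last by exists x.
exists y; split=> //; rewrite ltnNge; apply: contraTN le1 => dy; rewrite -ltnNge.
apply: (@leq_trans #|[set x; y]|); first by rewrite cards2 xy.
by apply: subset_leq_card; apply/subsetP=> z /set2P[]->; rewrite inE ?lx ?dx ?ly ?dy.
Qed.
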